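(* Let $G$ be a finite group, $N\trianglelefteq G$, and let $\omega$ be an irreducible complex representation of $N$ with $\alpha(\omega)=1$. If $G/N$ is solvable, then the induced representation $\omega^G$ has an irreducible component $\rho$ satisfying $\alpha(\rho)=1$.
   Context: All representations are finite-dimensional complex unitary representations. For a representation $\rho:G\to GL(V)$ of a finite group $G$, let $S(V)$ be the unit sphere of $V$ and $G(x)$ the $G$-orbit of $x$. The $\alpha$-characteristic of $\rho$ is $\alpha(\rho):=\gcd\{|G(x)| : x\in S(V)\}$. The $\alpha$-characteristic of a representation of $N$ is computed with $N$-orbits. $\omega^G$ denotes the representation of $G$ induced from $\omega$. *)

(* Defs.v *)
From HB Require Import structures.
From mathcomp Require Import all_boot all_order all_algebra all_fingroup.
From mathcomp Require Import all_solvable all_character.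
From mathcomp Require Import finmap boolp reals complex.

Set Implicit Arguments.
Unset Strict Implicit.
Unset Printing Implicit Defensive.

Import GroupScope GRing.Theory Num.Theory.
Local Open Scope ring_scope.
Local Open Scope sesquilinear_scope.

Section Alpha.
Variables (C : numClosedFieldType) (gT : finGroupType) (G : {group gT}).

(* Outside G the values of a mx_representation are unconstrained. *)
Definition unitary_repr n (rG : mx_representation C G n) : Prop :=
  {in G, forall g, rG g \is unitarymx}.

(* As everywhere in mxrepresentation, groups act on row vectors from the
   right.  This is the orbit of v. *)
Definition repr_orbit n (rG : mx_representation C G n) (v : 'rV[C]_n) :
    {fset 'rV[C]_n} :=
  [fset v *m rG g | g in G]%fset.

Definition unit_sphere n (v : 'rV[C]_n) : Prop := dotmx v v = 1.

Definition orbit_size n (rG : mx_representation C G n) (k : nat) : Prop :=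
  exists2 v, unit_sphere v & #|` repr_orbit rG v| = k.

(* Orbits have at most #|G| points, so bounding k by #|G| loses nothing: see
   alpha_gcdP. *)
Definition alpha n (rG : mx_representation C G n) : nat :=
  \big[gcdn/0%N]_(k < #|G|.+1 | `[< orbit_size rG k >]) k.

Lemma orbit_size_le n (rG : mx_representation C G n) k :
  orbit_size rG k -> (k <= #|G|)%N.
Proof. by case=> v _ <-; apply: (leq_trans (leq_imfset_card _ _ _)); rewrite cardE. Qed.

Lemma alpha_gcdP n (rG : mx_representation C G n) d :
  reflect (forall k, orbit_size rG k -> (d %| k)%N) (d %| alpha rG)%N.
Proof.
apply: (iffP (dvdn_biggcdP _ _ _)) => [dv k sk | dv i /asboolP]; last exact: dv.
have lek : (k < #|G|.+1)%N by rewrite ltnS (orbit_size_le sk).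
by apply: (dv (Ordinal lek)); apply/asboolP.
Qed.

(* rH is isomorphic to a subrepresentation of rG. *)
Definition is_component d n
    (rH : mx_representation C G d) (rG : mx_representation C G n) : Prop :=
  exists (U : 'M[C]_n) (modU : mxmodule rG U), mx_rsim rH (submod_repr modU).

End Alpha.

Section Induced.
Variables (C : numClosedFieldType) (gT : finGroupType) (G H : {group gT}).
Hypothesis sHG : H \subset G.
Variables (n : nat) (w : mx_representation C H n).

Definition coset_rep (i : 'I_#|G : H|) : gT :=
  repr (enum_val (i : 'I_#|rcosets H G|)).

(* The space of w^G is the direct sum over i of copies (W (x) t_i) of the space
   W of w, with t_i = coset_rep i; since (u (x) t_i) g =
   (u w(t_i g t_j^-1)) (x) t_j when t_i g t_j^-1 \in H, these are the blocks. *)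
Definition ind_block (g : gT) (i j : 'I_#|G : H|) : 'M[C]_n :=
  let h := (coset_rep i * g * (coset_rep j)^-1)%g in
  if h \in H then w h else 0.

Definition ind_mx (g : gT) : 'M[C]_(\sum_(i < #|G : H|) n) :=
  \mxblock_(i < #|G : H|, j < #|G : H|) ind_block g i j.

Lemma coset_rep_coset i : (H :* coset_rep i)%g = enum_val (i : 'I_#|rcosets H G|).
Proof. by rewrite /coset_rep; case/rcosetsP: (enum_valP i) => x _ ->; rewrite rcoset_repr. Qed.

Lemma coset_rep_in i : coset_rep i \in G.
Proof.
rewrite /coset_rep; case/rcosetsP: (enum_valP i) => x Gx ->.
case: repr_rcosetP => h Hh; rewrite groupM //; exact: (subsetP sHG).
Qed.

Lemma coset_rep_ex x : x \in G -> exists j, forall k,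
  ((x * (coset_rep k)^-1)%g \in H) = (k == j).
Proof.
move=> Gx; have Hx : (H :* x)%g \in rcosets H G by apply/rcosetsP; exists x.
exists (enum_rank_in Hx (H :* x)%g) => k.
rewrite -mem_rcoset (sameP rcoset_eqP eqP) coset_rep_coset.
rewrite -{1}(enum_rankK_in Hx Hx) eq_sym.
by rewrite (inj_eq enum_val_inj).
Qed.

Lemma ind_mx_repr : mx_repr G ind_mx.
Proof.
split=> [|x y Gx Gy].
  rewrite -mxdiagZ; apply: eq_mxblock => i j; rewrite /ind_block mulg1.
  have [j0 Ej0] := coset_rep_ex (coset_rep_in i).
  have: i == j0 by rewrite -Ej0 mulgV group1.
  rewrite Ej0 => /eqP <-; rewrite eq_sym; case: eqP => [<-|//].
  by rewrite mulgV repr_mx1 conform_mx_id.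
rewrite /ind_mx mul_mxblock; apply: eq_mxblock => i k; rewrite /ind_block.
have [j0 Ej0] := coset_rep_ex (groupM (coset_rep_in i) Gx).
rewrite (bigD1 j0) //= Ej0 eqxx big1 => [|j /negPf nj]; last first.
  by rewrite Ej0 nj mul0mx.
have Hh : (coset_rep i * x * (coset_rep j0)^-1 \in H)%g by rewrite Ej0.
have -> : (coset_rep i * (x * y) * (coset_rep k)^-1 =
  (coset_rep i * x * (coset_rep j0)^-1)
  * (coset_rep j0 * y * (coset_rep k)^-1))%g by rewrite !mulgA mulgKV.
rewrite addr0 groupMl //; case: ifP => [Hk|_]; last by rewrite mulmx0.
by rewrite repr_mxM.
Qed.

Definition ind_repr := MxRepresentation ind_mx_repr.

Lemma ind_repr_unitary : unitary_repr w -> unitary_repr ind_repr.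
Proof.
move=> uw g Gg; apply/unitarymxP.
suff -> : (ind_repr g)^t* = ind_repr g^-1%g.
  by rewrite -repr_mxM ?groupV // mulgV repr_mx1.
apply/mxblockP => i j; rewrite [RHS]mxblockK.
rewrite /= /ind_mx tr_mxblock.
have -> (B : forall i j : 'I_#|G : H|, 'M[C]_n) (f : C -> C) :
    map_mx f (\mxblock_(i, j) B i j) = \mxblock_(i, j) map_mx f (B i j).
  by apply/matrixP => s t; rewrite !mxE.
rewrite mxblockK /ind_block.
set h := (coset_rep j * g * _)%g.
have -> : (coset_rep i * g^-1 * (coset_rep j)^-1)%g = h^-1%g.
  by rewrite /h !invMg invgK mulgA.
rewrite groupV; case: ifP => [Hh|_]; last by rewrite trmx0 map_mx0.
by rewrite repr_mxV // invmx_unitary // uw.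
Qed.

End Induced.

(* Main.v *)
(* A representation has alpha-characteristic 1 iff, for every prime p, a Sylow
   p-subgroup fixes a nonzero vector.  By solvability we may climb from N to G
   through normal subgroups of prime index, so let #|G : N| = q be prime.  If
   Q is a Sylow q-subgroup of G, then Q :&: N fixes a nonzero vector of w, so Q
   fixes a nonzero vector u of w^G; choose an irreducible component rho of w^G
   onto which u projects nontrivially.  For p != q the Sylow p-subgroups of N
   are Sylow in G, and they fix nonzero vectors in rho because the restriction
   of rho to N contains w. *)
Require Import Defs.
From mathcomp Require Import all_boot all_order all_algebra all_fingroup.
From mathcomp Require Import all_solvable all_character.
From mathcomp Require Import finmap boolp reals complex.

Set Implicit Arguments.
Unset Strict Implicit.
Unset Printing Implicit Defensive.

Import Order.TTheory GroupScope GRing.Theory Num.Theory.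
Local Open Scope group_scope.
Local Open Scope ring_scope.
Local Open Scope sesquilinear_scope.

(** * Orbit sizes and vectors fixed by Sylow subgroups *)

Section FixedVectors.
Variables (C : numClosedFieldType) (gT : finGroupType) (G : {group gT}).

(** Orbit-stabilizer: [v *m rG x] depends only on the right coset of the stabilizer containing [x],
    and separates these cosets. *)
Lemma card_repr_orbit n (rG : mx_representation C G n) (v : 'rV_n) :
  #|` repr_orbit rG v| = #|G : rstab rG v|.
Proof.
have stabP x y : x \in G -> y \in G ->
    (v *m rG x == v *m rG y) = (rstab rG v :* x == rstab rG v :* y)%g.
  move=> Gx Gy.
  rewrite -[RHS](sameP rcoset_eqP eqP) mem_rcoset inE groupM ?groupV //=.
  rewrite repr_mxM ?groupV // mulmxA.
  by rewrite (can2_eq (repr_mxKV rG Gy) (repr_mxK rG Gy)).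
have reprG (A : {set gT}) : A \in rcosets (rstab rG v) G ->
    repr A \in G /\ A = (rstab rG v :* repr A)%g.
  case/rcosetsP=> x Gx ->; rewrite rcoset_repr; split=> //.
  case: repr_rcosetP => h /setIdP[Gh _]; exact: groupM.
have -> : repr_orbit rG v =
    [fset v *m rG (repr A) | A in rcosets (rstab rG v) G]%fset.
  apply/fsetP=> u; apply/imfsetP/imfsetP=> -[x /= Gx ->].
    have Rx : (rstab rG v :* x)%g \in rcosets (rstab rG v) G.
      by apply/rcosetsP; exists x.
    exists (rstab rG v :* x)%g => //=; apply/eqP.
    by have [Gr eR] := reprG _ Rx; rewrite stabP // -eR.
  by have [Gr _] := reprG _ Gx; exists (repr x).
rewrite card_in_imfset /= -?cardE // => A B RA RB /eqP.
have [GA eA] := reprG _ RA; have [GB eB] := reprG _ RB.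
by rewrite stabP // -eA -eB => /eqP.
Qed.

Lemma unit_sphere_scale n (v : 'rV[C]_n) :
  v != 0 -> exists2 c, c != 0 & unit_sphere (c *: v).
Proof.
move=> nzv; have dv : 0 < dotmx v v by apply: dotmx_is_dotmx.
exists (sqrtC (dotmx v v))^-1.
  by rewrite invr_eq0 sqrtC_eq0 gt_eqF.
rewrite /unit_sphere (dnormZ (@dotmx C n)) normfV exprVn.
by rewrite ger0_norm ?sqrtC_ge0 ?ltW // sqrtCK mulVf ?gt_eqF.
Qed.

(** If [p] does not divide [alpha rG], some orbit has size prime to [p], so a Sylow [p]-subgroup of
    the stabilizer is Sylow in [G]. Conversely, a normalized vector fixed by [P] has orbit size
    dividing [#|G : P|]. *)
Lemma alpha_eq1P n (rG : mx_representation C G n) :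
  alpha rG = 1%N <->
  forall p, prime p ->
    exists2 P : {group gT}, p.-Sylow(G) P & rfix_mx rG P != 0.
Proof.
split=> [a1 p p_pr | fixP].
  have: ~~ (p %| alpha rG)%N by rewrite a1 dvdn1 neq_ltn prime_gt1 ?orbT.
  case/alpha_gcdP/existsNP=> k /not_implyP[[v v1 <-] /negP].
  rewrite card_repr_orbit => p'i.
  have [P sylP] := Sylow_exists p (rstab_group rG v).
  exists P.
    have [sPS pP _] := and3P sylP.
    have sSG := rstab_sub rG v.
    rewrite /pHall (subset_trans sPS sSG) pP -(Lagrange_index sSG sPS) /=.
    rewrite pnatM; apply/andP; split; last by case/and3P: sylP.
    by rewrite p'natE.
  apply: contraTneq (oner_neq0 C) => fix0; rewrite negbK.
  have: (v <= rfix_mx rG P)%MS.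
    have sPS := pHall_sub sylP.
    by rewrite -rfix_mx_rstabC // (subset_trans sPS) ?rstab_sub.
  rewrite fix0 submx0 => /eqP v0; rewrite -(v1 : dotmx v v = 1) v0.
  by rewrite dotmxE mul0mx mxE.
have dvdP p : prime p -> ~~ (p %| alpha rG)%N.
  move=> p_pr; have [P sylP /rowV0Pn[v Pv nzv]] := fixP p p_pr.
  have [c nzc v1] := unit_sphere_scale nzv.
  apply/negP=> /alpha_gcdP /(_ _ (ex_intro2 _ _ (c *: v) v1 erefl)).
  rewrite card_repr_orbit; apply/negP; rewrite -p'natE //.
  have sPS : P \subset rstab rG (c *: v).
    by rewrite rfix_mx_rstabC ?scalemx_sub ?(pHall_sub sylP).
  have [_ _] := and3P sylP.
  by rewrite -(Lagrange_index (rstab_sub rG (c *: v)) sPS) pnatM => /andP[].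
apply/eqP; rewrite eqn_leq; apply/andP; split.
  rewrite leqNgt; apply/negP=> /pdiv_prime p_pr.
  by have:= dvdP _ p_pr; rewrite pdiv_dvd.
(* The value 0, the gcd over an empty sphere, is excluded since 2 divides it. *)
by rewrite lt0n; apply: contraNneq (dvdP 2 isT) => ->.
Qed.

(** Half of Schur's lemma: the kernel of [D] is a proper submodule. A bare function [f] also covers
    representations of larger groups. *)
Lemma intertwiner_row_free n (rG : mx_representation C G n) d (f : gT -> 'M_d)
    (D : 'M_(n, d)) :
  mx_irreducible rG -> D != 0 ->
  {in G, forall g, rG g *m D = D *m f g} -> row_free D.
Proof.
case/mx_irrP=> _ irrG nzD homD.
have modK : mxmodule rG (kermx D).
  apply/mxmoduleP=> x Gx; apply/sub_kermxP.
  by rewrite -mulmxA homD // mulmxA mulmx_ker mul0mx.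
rewrite -kermx_eq0; apply: contraNT nzD => /(irrG _ modK) fullK.
by rewrite -(mul1mx D); apply/eqP/sub_kermxP; rewrite sub1mx.
Qed.

Lemma unitary_repr_tC n (rG : mx_representation C G n) g :
  unitary_repr rG -> g \in G -> (rG g)^t* = rG g^-1%g.
Proof. by move=> uG Gg; rewrite repr_mxV // invmx_unitary ?uG. Qed.

End FixedVectors.

(** * Adjoints and irreducible components of unitary representations *)

Section UnitaryComponents.
Variables (C : numClosedFieldType) (gT : finGroupType) (G : {group gT}).

(** Take adjoints in the relation at [g^-1]. *)
Lemma adjoint_intertwiner n m (r1 : mx_representation C G n)
    (r2 : mx_representation C G m) (D : 'M_(n, m)) :
  unitary_repr r1 -> unitary_repr r2 ->
  {in G, forall g, r1 g *m D = D *m r2 g} ->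
  {in G, forall g, r2 g *m D^t* = D^t* *m r1 g}.
Proof.
move=> u1 u2 homD g Gg.
have Gg' : g^-1%g \in G by rewrite groupV.
have := congr1 (fun M => M^t*) (homD _ Gg').
by rewrite !trmx_mul !map_mxM !unitary_repr_tC // !invgK => ->.
Qed.

Lemma unitarymx_subK m1 m2 n (X : 'M[C]_(m1, n)) (B : 'M_(m2, n)) :
  B \is unitarymx -> (X <= B)%MS -> X *m B^t* *m B = X.
Proof. by move=> uB /submxP[Y ->]; rewrite mulmxtVK. Qed.

(** Gram-Schmidt gives an orthonormal basis [B] of [U], in which the action on [U] has unitary
    matrices. *)
Lemma unitary_simple_submodule n (r : mx_representation C G n) (U : 'M_n) :
    unitary_repr r -> mxsimple r U ->
  exists d (rho : mx_representation C G d) (B : 'M_(d, n)),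
    [/\ unitary_repr rho, mx_irreducible rho, (B :=: U)%MS
      & {in G, forall g, rho g *m B = B *m r g}].
Proof.
move=> ur [modU nzU simU]; pose B := schmidt (row_base U).
have eB : (B :=: U)%MS.
  by apply: eqmx_trans (eq_row_base U); apply/eqmx_schmidt_free/row_base_free.
have uB : B \is unitarymx by apply/schmidt_unitarymx/rank_leq_col.
have modB : mxmodule r B by rewrite (eqmx_module _ eB).
have BK m (X : 'M_(m, n)) g : (X <= B)%MS -> g \in G ->
    X *m r g *m B^t* *m B = X *m r g.
  move=> sXB Gg; rewrite unitarymx_subK //.
  exact: submx_trans (submxMr _ sXB) (mxmoduleP modB g Gg).
pose f g := B *m r g *m B^t*.
have fP : mx_repr G f.
  split=> [|x y Gx Gy]; rewrite /f.
    by rewrite repr_mx1 mulmx1; apply/unitarymxP.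
  by rewrite repr_mxM // !mulmxA BK.
pose rho := MxRepresentation fP.
have homB : {in G, forall g, rho g *m B = B *m r g}.
  by move=> g Gg; rewrite BK.
exists (\rank U), rho, B; split=> //.
  move=> g Gg; apply/unitarymxP; rewrite /= /f.
  rewrite !trmx_mul !map_mxM trmxCK unitary_repr_tC // !mulmxA BK //.
  rewrite -[X in X *m _ = _]mulmxA -repr_mxM ?groupV // mulgV repr_mx1.
  by rewrite mulmx1; apply/unitarymxP.
apply/mx_irrP; split; first by rewrite lt0n mxrank_eq0.
(* A submodule [V] of [rho] embeds as the submodule [V *m B] of [U]. *)
move=> V modV nzV; have freeB : row_free B by rewrite /row_free mxrank_unitary.
have := simU <<V *m B>>%MS; rewrite (eqmx_module _ (genmxE _)) !genmxE.
rewrite (eqmx_eq0 (genmxE _)).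
have sVBU : (V *m B <= U)%MS by apply: submx_trans (submxMl V B) _; rewrite eB.
have nzVB : V *m B != 0 by rewrite -mxrank_eq0 mxrankMfree // mxrank_eq0.
have modVB : mxmodule r (V *m B).
  apply/mxmoduleP=> g Gg; rewrite -mulmxA -homB // mulmxA submxMr //.
  exact: (mxmoduleP modV).
move/(_ modVB sVBU nzVB)/mxrankS; rewrite mxrankMfree //.
by rewrite /row_full eqn_leq rank_leq_col.
Qed.

(** By Maschke the space is a sum of simple submodules, and a nonzero [u] cannot be orthogonal to
    all of them. [T] is the adjoint of the embedding of one not orthogonal to [u]. *)
Lemma unitary_component_nonorth n (r : mx_representation C G n) (u : 'rV_n) :
    unitary_repr r -> u != 0 ->
  exists d (rho : mx_representation C G d) (T : 'M_(n, d)),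
    [/\ unitary_repr rho, mx_irreducible rho, u *m T != 0
      & {in G, forall g, r g *m T = T *m rho g}].
Proof.
move=> ur nzu; apply: contrapT => noT.
have redr : mx_completely_reducible r 1%:M.
  by apply: mx_Maschke_pchar; rewrite /pgroup pcharf'_nat pnatr_eq0 -lt0n.
(* Semisimplicity comes under [classically], which eliminates only into booleans. *)
suff: false by [].
apply: (mx_reducible_semisimple (mxmodule1 r) redr) => -[I W /= simW defW _].
have: (\sum_i W i <= kermx (u^t*))%MS.
  apply/sumsmx_subP=> i _.
  have [d [rho [B [urho irho eB homB]]]] := unitary_simple_submodule ur (simW i).
  rewrite -eB; apply/sub_kermxP; rewrite -[B]trmxCK -map_mxM -trmx_mul.
  suff -> : u *m B^t* = 0 by rewrite trmx0 map_mx0.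
  apply: contra_notP noT => /eqP nz_uB; exists d, rho, (B^t*); split=> //.
  exact: adjoint_intertwiner homB.
rewrite defW => /sub_kermxP; rewrite mul1mx => u0; case/eqP: nzu.
by rewrite -[u]trmxCK u0 trmx0 map_mx0.
Qed.

End UnitaryComponents.

(** * Fixed vectors and components of the induced representation *)

Section InducedComponents.
Variables (C : numClosedFieldType) (gT : finGroupType) (G H : {group gT}).
Hypothesis sHG : H \subset G.
Variables (n : nat) (w : mx_representation C H n).
Local Notation t_ := (@coset_rep gT G H).
Local Notation wG := (ind_repr sHG w).

(* Row of blocks representing W (x) x inside w^G, so that the block rows of
   ind_mx g are the ind_row (t_i * g). *)
Definition ind_row (x : gT) : 'M[C]_(n, \sum_(j < #|G : H|) n) :=
  \mxrow_j (let h := (x * (t_ j)^-1)%g in if h \in H then w h else 0).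

Lemma ind_row_act x g : x \in G -> g \in G ->
  ind_row x *m wG g = ind_row (x * g)%g.
Proof.
move=> Gx Gg; rewrite /ind_row /= /ind_mx mul_mxrow_mxblock.
apply: eq_mxrow => k; have [j0 Ej0] := coset_rep_ex H Gx.
rewrite (bigD1 j0) //= Ej0 eqxx big1 => [|j /negPf nj]; last first.
  by rewrite Ej0 nj mul0mx.
have Hh : (x * (t_ j0)^-1)%g \in H by rewrite Ej0.
have -> : (x * g * (t_ k)^-1 = (x * (t_ j0)^-1) * (t_ j0 * g * (t_ k)^-1))%g.
  by rewrite !mulgA mulgKV.
rewrite addr0 /ind_block [in RHS]groupMl //.
case: ifP => [Hk|_]; last by rewrite mulmx0.
by rewrite [RHS]repr_mxM.
Qed.

Lemma ind_row_mul h x : h \in H -> x \in G ->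
  w h *m ind_row x = ind_row (h * x)%g.
Proof.
move=> Hh Gx; rewrite /ind_row mul_mxrow; apply: eq_mxrow => j /=.
rewrite -mulgA [in RHS]groupMl //; case: ifP => [Hk|_]; last by rewrite mulmx0.
by rewrite [RHS]repr_mxM.
Qed.

Lemma ind_row1_hom : {in H, forall h, w h *m ind_row 1 = ind_row 1 *m wG h}.
Proof.
by move=> h Hh; rewrite ind_row_mul // ind_row_act ?(subsetP sHG) // mulg1 mul1g.
Qed.

(** Acting by [P] permutes the terms of [u]. In the block of the coset [H], only the terms with [x]
    in [P :&: H] contribute, all equally, so nothing cancels in characteristic 0. *)
Lemma ind_fixed_vector (P : {group gT}) (v : 'rV_n) :
    P \subset G -> v != 0 -> (v <= rfix_mx w (P :&: H)%SET)%MS ->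
  let u := \sum_(x in P) v *m ind_row x in
  u != 0 /\ (u <= rfix_mx wG P)%MS.
Proof.
move=> sPG nzv /rfix_mxP fixv u; split; last first.
  apply/rfix_mxP=> g Pg; rewrite {2}/u (reindex_acts 'R _ Pg) ?astabsR //=.
  rewrite mulmx_suml; apply: eq_bigr => x Px.
  by rewrite -mulmxA ind_row_act ?(subsetP sPG).
have [j Ej] := coset_rep_ex H (group1 G).
have Ht : (t_ j)^-1%g \in H by rewrite -[_^-1%g]mul1g Ej.
have: submxrow u j = #|P :&: H|%:R *: (v *m w (t_ j)^-1%g).
  rewrite submxrow_sum (bigID [in H]) /= [X in _ + X]big1 => [|x /andP[_ H'x]].
    rewrite addr0 scaler_nat -sumr_const; apply: eq_big => x; first by rewrite inE.
    case/andP=> Px Hx; rewrite -mul_submxrow mxrowK /= groupMr // Hx.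
    by rewrite repr_mxM // mulmxA fixv // inE Px.
  by rewrite -mul_submxrow mxrowK /= groupMr // (negPf H'x) mulmx0.
apply: contra_eq_neq => ->; rewrite submxrow0 eq_sym scaler_eq0 negb_or.
rewrite pnatr_eq0 -lt0n cardG_gt0 /=; apply: contraNneq nzv => vw0.
by rewrite -(repr_mxK w Ht v) vw0 mul0mx.
Qed.

(** The result is phrased with an intertwiner [D] because such maps compose along a chain of
    subgroups. *)
Lemma unitary_component_prime_index :
    H <| G -> prime #|G : H| ->
    unitary_repr w -> mx_irreducible w -> alpha w = 1%N ->
  exists d (rho : mx_representation C G d) (D : 'M_(n, d)),
    [/\ unitary_repr rho, mx_irreducible rho, alpha rho = 1%N, D != 0
      & {in H, forall h, w h *m D = D *m rho h}].
Proof.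
move=> nHG pr_q uw irrw /alpha_eq1P fixw; set q := #|G : H| in pr_q.
have [S sylS /rowV0Pn[v Sv nzv]] := fixw q pr_q.
have [sSH qS _] := and3P sylS.
have [P sylP sSP] := Sylow_superset (subset_trans sSH sHG) qS.
have [sPG qP _] := and3P sylP.
have PH_S : P :&: H = S.
  apply: (sub_pHall sylS); rewrite ?subsetIr ?subsetI ?sSP //.
  by rewrite (pgroupS _ qP) ?subsetIl.
have [] := ind_fixed_vector sPG nzv; first by rewrite PH_S.
set u := \sum_(x in P) _ => nzu Pu.
have [d [rho [T [urho irho nz_uT homT]]]] :=
  unitary_component_nonorth (ind_repr_unitary sHG uw) nzu.
have homD : {in H, forall h, w h *m (ind_row 1 *m T) = ind_row 1 *m T *m rho h}.
  move=> h Hh; rewrite mulmxA ind_row1_hom // -[LHS]mulmxA homT ?mulmxA //.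
  exact: (subsetP sHG).
(* Each [ind_row x] is the translate of [ind_row 1] by [x]; if [T] killed the latter, it would kill
   [u]. *)
have nzD : ind_row 1 *m T != 0.
  apply: contraNneq nz_uT => D0; rewrite mulmx_suml big1 // => x Px.
  have Gx := subsetP sPG x Px.
  rewrite -[x]mul1g -ind_row_act // -!mulmxA homT // !mulmxA.
  by rewrite -(mulmxA v) D0 mulmx0 mul0mx.
exists d, rho, (ind_row 1 *m T); split=> //; apply/alpha_eq1P => p p_pr.
have [-> | p'q] := eqVneq p q.
  exists P => //; apply/rowV0Pn; exists (u *m T) => //.
  apply/rfix_mxP=> x Px; rewrite -mulmxA -homT ?(subsetP sPG) // mulmxA.
  by rewrite (rfix_mxP _ Pu).
have [Q sylQ /rowV0Pn[z Qz nzz]] := fixw p p_pr.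
have [sQH pQ p'HQ] := and3P sylQ.
exists Q.
  (* The index of [Q] in [G] is [q] times its index in [H], hence prime to [p]. *)
  rewrite /pHall (subset_trans sQH sHG) pQ -(Lagrange_index sHG sQH) /=.
  by rewrite pnatM p'HQ pnatE // inE /= andbT !inE eq_sym.
apply/rowV0Pn; exists (z *m (ind_row 1 *m T)).
  apply/rfix_mxP=> x Qx; rewrite -mulmxA -homD ?(subsetP sQH) // mulmxA.
  by rewrite (rfix_mxP _ Qz).
have freeD := intertwiner_row_free irrw nzD homD.
by rewrite -mxrank_eq0 mxrankMfree // mxrank_eq0.
Qed.

(* Frobenius reciprocity: the adjoint of D induces to a map from rho to w^G. *)
Lemma component_ind d (rho : mx_representation C G d) (D : 'M_(n, d)) :
    unitary_repr w -> unitary_repr rho -> mx_irreducible rho -> D != 0 ->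
    {in H, forall h, w h *m D = D *m rho h} ->
  is_component rho wG.
Proof.
move=> uw urho irho nzD homD.
have urhoH : unitary_repr (subg_repr rho sHG).
  by move=> g /(subsetP sHG); apply: urho.
have homA := adjoint_intertwiner uw urhoH homD.
set A := D^t* in homA.
have nzA : A != 0.
  by apply: contraNneq nzD => A0; rewrite -[D]trmxCK -/A A0 trmx0 map_mx0.
(* [F] sends [a] to the sum over [j] of ([a *m rho (t_ j)^-1 *m A]) (x) [t_ j]. *)
pose F : 'M_(d, \sum_(j < #|G : H|) n) := \mxrow_j (rho (t_ j)^-1%g *m A).
have Gt j : t_ j \in G by apply: coset_rep_in.
have homF : {in G, forall g, rho g *m F = F *m wG g}.
  move=> g Gg; rewrite /F /= /ind_mx mul_mxrow_mxblock mul_mxrow.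
  apply: eq_mxrow => k.
  (* In block column [k] of [wG g], only the row of the coset of [t_ k * g^-1] contributes. *)
  have Gx : (t_ k * g^-1)%g \in G by rewrite groupM ?groupV.
  have [j Ej] := coset_rep_ex H Gx.
  have EjV i : ((t_ i * g * (t_ k)^-1)%g \in H) = (i == j).
    by rewrite -Ej -groupV !invMg !invgK mulgA.
  rewrite (bigD1 j) //= big1 => [|i /negPf nij]; last first.
    by rewrite /ind_block EjV nij mulmx0.
  have Hh : (t_ j * g * (t_ k)^-1)%g \in H by rewrite EjV.
  rewrite addr0 /ind_block Hh -[RHS]mulmxA -homA //= !mulmxA.
  by rewrite -!repr_mxM ?groupM ?groupV // !mulgA mulVg mul1g.
have nzF : F != 0.
  have [j _] := coset_rep_ex H (group1 G).
  apply: contraNneq nzA => F0.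
  have := congr1 (fun M => submxrow M j) F0; rewrite mxrowK submxrow0 => rA0.
  rewrite -(mul1mx A) -(repr_mx1 rho) -(mulgV (t_ j)) repr_mxM ?groupV //.
  by rewrite -mulmxA rA0 mulmx0.
have freeF := intertwiner_row_free irho nzF homF.
have modF : mxmodule wG <<F>>%MS.
  rewrite (eqmx_module _ (genmxE _)); apply/mxmoduleP=> g Gg.
  by rewrite -homF // submxMl.
exists <<F>>%MS, modF; have sFF : (F <= <<F>>)%MS by rewrite genmxE.
exists (in_submod <<F>>%MS F).
- by rewrite genmxE (eqP freeF).
- by rewrite /row_free mxrank_in_submod // (eqP freeF).
move=> g Gg; rewrite -in_submodJ // -homF //.
by rewrite [in_submod _ F]in_submodE [RHS]in_submodE mulmxA.
Qed.

End InducedComponents.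

(** * Climbing from [N] to [G] *)

Lemma exists_alpha1_intertwiner (C : numClosedFieldType) (gT : finGroupType)
    (G N : {group gT}) (n : nat) (w : mx_representation C N n) :
    N <| G -> solvable (G / N)%g ->
    unitary_repr w -> mx_irreducible w -> alpha w = 1%N ->
  exists d (rho : mx_representation C G d) (D : 'M_(n, d)),
    [/\ unitary_repr rho, mx_irreducible rho, alpha rho = 1%N, D != 0
      & {in N, forall h, w h *m D = D *m rho h}].
Proof.
move=> nNG solGN uw irrw alw; have [m leGm] := ubnP #|G|.
elim: m => // m IHm in G nNG solGN leGm *.
have [GN1 | ntGN] := eqVneq (G / N)%g 1%g.
  have eGN : G :=: N.
    apply/eqP; rewrite eqEsubset (normal_sub nNG) andbT.
    by rewrite -quotient_sub1 ?normal_norm // GN1.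
  have -> : G = N by apply: group_inj.
  exists n, w, 1%:M; split=> //; last by move=> h _; rewrite mulmx1 mul1mx.
  by case: irrw.
(* Lift a normal subgroup of prime index in [G / N] to [M], which contains [N] and has the same
   index in [G]. *)
have [Mbar nMbar pr_q] := sol_prime_factor_exists solGN ntGN.
have [M defM sNM nMG] := inv_quotientN nNG nMbar.
have nNM : N <| M := normalS sNM (normal_sub nMG) nNG.
have iMG : #|G : M| = #|G / N : Mbar|%g.
  rewrite defM index_quotient_eq ?normal_norm ?(normal_sub nMG) //.
  exact: subset_trans (subsetIr _ _) sNM.
rewrite -iMG in pr_q.
have ltMm : (#|M| < m)%N.
  rewrite -ltnS; apply: leq_trans leGm; rewrite ltnS.
  rewrite -(Lagrange (normal_sub nMG)) -{1}[#|M|]muln1.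
  by rewrite ltn_pmul2l ?prime_gt1 ?cardG_gt0.
have solMN : solvable (M / N)%g.
  by rewrite (solvableS _ solGN) ?quotientS ?normal_sub.
have [d1 [r1 [D1 [u1 i1 a1 nzD1 hom1]]]] := IHm M nNM solMN ltMm.
have [d [rho [D [urho irho arho nzD homD]]]] :=
  unitary_component_prime_index (normal_sub nMG) nMG pr_q u1 i1 a1.
exists d, rho, (D1 *m D); split=> //.
  (* Irreducibility of [r1] makes [D] injective, so the composite stays nonzero. *)
  have freeD := intertwiner_row_free i1 nzD homD.
  by rewrite -mxrank_eq0 mxrankMfree // mxrank_eq0.
move=> h Nh; rewrite mulmxA hom1 // -[LHS]mulmxA homD ?mulmxA //.
exact: (subsetP sNM).
Qed.

Theorem proposition5p5 (R : realType) (gT : finGroupType) (G N : {group gT})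
    (nNG : N <| G) (n : nat) (w : mx_representation R[i] N n)
    (unitary_w : unitary_repr w) (irr_w : mx_irreducible w)
    (alpha_w : alpha w = 1%N) (solGN : solvable (G / N)%g) :
  exists (d : nat) (rho : mx_representation R[i] G d),
    [/\ unitary_repr rho, mx_irreducible rho,
        is_component rho (ind_repr (normal_sub nNG) w) & alpha rho = 1%N].
Proof.
have [d [rho [D [urho irho arho nzD homD]]]] :=
  exists_alpha1_intertwiner nNG solGN unitary_w irr_w alpha_w.
exists d, rho; split=> //.
(* Reciprocity is applied once, directly from [N] to [G]. *)
by apply: (component_ind (normal_sub nNG) unitary_w urho irho nzD homD).
Qed.
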